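(* Let $n>8$, let $C_n$ be the cycle graph on $n$ vertices with adjacency matrix $A_{C_n}$, and let $P$ be an $n\times n$ permutation matrix. Then $A_{C_n}PA_{C_n}$ is symmetric if and only if $P$ is symmetric. In other words, there is no permutational $1$-st power of $C_n$ with respect to a permutation $p$ with $p^2\neq\mathrm{id}$.
   Context: For a graph $H$ with adjacency matrix $A_H$ and a permutation $p\in Sym(|V_H|)$ with permutation matrix $P$, if $A_HPA_H$ is symmetric, the graph with adjacency matrix $A_HPA_H$ is called the permutational $1$-st power of $H$ with respect to $p$. *)

(* Defs.v *)
From HB Require Import structures.
From mathcomp Require Import all_boot all_order all_algebra all_fingroup.

Set Implicit Arguments.
Unset Strict Implicit.
Unset Printing Implicit Defensive.

Import GRing.Theory.
Local Open Scope ring_scope.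

(* Undirected graphs on the vertex set 'I_n, with loops and multiple edges
   allowed: the entries of A_H P A_H may exceed 1 and lie on the diagonal.
   [mult u v] is the (u, v) entry of the adjacency matrix. *)
Record graph (n : nat) := Graph {
  mult : 'I_n -> 'I_n -> nat;
  mult_sym : forall u v, mult u v = mult v u
}.

Definition adjmx (n : nat) (G : graph n) : 'M[int]_n :=
  \matrix_(u, v) (mult G u v)%:Z.

Definition symmx (n : nat) (M : 'M[int]_n) : Prop := M^T = M.

(* [ordS u] is the successor of u modulo n; for n > 2 this is the usual simple
   cycle of length n. *)
Definition cycle_mult (n : nat) (u v : 'I_n) : nat :=
  (v == ordS u) || (u == ordS v).

Lemma cycle_mult_sym (n : nat) (u v : 'I_n) : cycle_mult u v = cycle_mult v u.
Proof. by rewrite /cycle_mult orbC. Qed.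

Definition cycle_graph (n : nat) : graph n := Graph (@cycle_mult_sym n).

Definition is_perm_power1 (n : nat) (H : graph n) (p : 'S_n) (G : graph n)
    : Prop :=
  let M := adjmx H *m perm_mx p *m adjmx H in
  symmx M /\ adjmx G = M.

(* Main.v *)
(* Write A for the adjacency matrix and D = P - P^T, so that the hypothesis is
   A D A = 0.  A vector x with A x = 0 satisfies x_(u+2) = - x_u, so if it is
   nonzero then its support contains u, u + 2, u + 4, ..., that is, at least n/2
   vertices.  A column of D A is a sum of two columns of D and has at most four
   nonzero entries, fewer than n/2, hence D A = 0; the same bound applied to
   the columns of D^T gives D = 0. *)
Require Import Defs.
From HB Require Import structures.
From mathcomp Require Import all_boot all_order all_algebra all_fingroup.

Set Implicit Arguments.
Unset Strict Implicit.
Unset Printing Implicit Defensive.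

Import GRing.Theory.
Local Open Scope ring_scope.

Lemma val_iter_ordS (n : nat) (u : 'I_n) (k : nat) :
  val (iter k (@ordS n) u) = ((u + k) %% n)%N.
Proof.
elim: k => [|k IHk] /=; first by rewrite addn0 modn_small.
by rewrite IHk -addn1 modnDml addn1 addnS.
Qed.

Lemma iter_ordS_inj (n : nat) (u : 'I_n) (j k : nat) :
  (j < n)%N -> (k < n)%N ->
  iter j (@ordS n) u = iter k (@ordS n) u -> j = k.
Proof.
move=> jn kn /(congr1 val); rewrite !val_iter_ordS => /eqP.
by rewrite eqn_modDl !modn_small // => /eqP.
Qed.

Lemma ordS_neq_ord_pred (n : nat) (u : 'I_n) :
  (2 < n)%N -> ordS u != ord_pred u.
Proof.
move=> n2; apply/eqP => /(congr1 (@ordS n)); rewrite ord_predK => e.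
by have := @iter_ordS_inj n u 2 0 n2 (ltn_trans _ n2) e; move/(_ isT).
Qed.

Lemma mulmx_adj_cycle (n : nat) (X : 'M[int]_n) (u v : 'I_n) : (2 < n)%N ->
  (adjmx (cycle_graph n) *m X) u v = X (ordS u) v + X (ord_pred u) v.
Proof.
(* For [2 < n] the two neighbours of [u] are distinct, so each contributes its own term to the
   sum. *)
move=> n2; rewrite mxE (bigD1 (ordS u)) //= (bigD1 (ord_pred u)) /=; last first.
  by rewrite eq_sym ordS_neq_ord_pred.
rewrite !mxE /= /cycle_mult eqxx ord_predK eqxx orbT !mul1r big1 ?addr0 //.
move=> w /andP[/negPf wS wp]; rewrite mxE /= /cycle_mult wS /=.
rewrite (_ : (u == ordS w) = false) ?mul0r //.
by apply: contra_neqF wp => /eqP ->; rewrite ordSK.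
Qed.

Lemma tr_adjmx (n : nat) (G : graph n) : (adjmx G)^T = adjmx G.
Proof. by apply/matrixP => u v; rewrite !mxE mult_sym. Qed.

Lemma eq0_of_adj_cycle_sparse (n m : nat) (X : 'M[int]_n) :
    (2 < n)%N -> (m.*2 < n)%N -> adjmx (cycle_graph n) *m X = 0 ->
    (forall v, exists2 s : seq 'I_n,
       (size s <= m)%N & forall u, X u v != 0 -> u \in s) ->
  X = 0.
Proof.
move=> n2 mn AX0 sparse; apply/matrixP => u v; rewrite mxE.
apply/eqP/contraT => Xuv; have [s sm sX] := sparse v.
(* This is row [ordS w] of [A X = 0], the neighbours of [ordS w] being [w] and [w + 2]. *)
have XSS w : X (ordS (ordS w)) v = - X w v.
  have := mulmx_adj_cycle X (ordS w) v n2.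
  by rewrite AX0 mxE ordSK => /esym/eqP; rewrite addr_eq0 => /eqP.
have Xiter k : X (iter k.*2 (@ordS n) u) v != 0.
  by elim: k => //= k IHk; rewrite XSS oppr_eq0.
(* The vertices [u, u + 2, ..., u + 2m]: since [2m < n] the offsets never wrap around, so for either
   parity of [n] these are [m + 1] distinct members of the support, one too many for [s]. *)
pose t := [seq iter k.*2 (@ordS n) u | k <- iota 0 m.+1].
have t_uniq : uniq t.
  rewrite map_inj_in_uniq ?iota_uniq // => j k.
  rewrite !mem_iota !add0n !ltnS /= => jm km /iter_ordS_inj e.
  by apply/double_inj/e; apply: leq_ltn_trans mn; rewrite leq_double.
have /(uniq_leq_size t_uniq) : {subset t <= s}.
  by move=> _ /mapP[k _ ->]; apply: sX.
by rewrite size_map size_iota ltnNge sm.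
Qed.

(** In column [v], the single 1 of [perm_mx p] is in row [p^-1 v] and that of its transpose in row
    [p v]. *)
Lemma perm_mx_subtr_neq0 (n : nat) (p : 'S_n) (u v : 'I_n) :
  (perm_mx p - (perm_mx p)^T : 'M[int]_n) u v != 0 ->
  u \in [:: p v; (p^-1)%g v].
Proof.
apply: contraR; rewrite !inE negb_or !mxE eq_sym => /andP[/negPf-> upv].
rewrite (_ : (p u == v) = false) //.
by apply: contra_neqF upv => /eqP <-; rewrite permK.
Qed.

Lemma symmx_cycle_perm_mx (n : nat) (p : 'S_n) : (8 < n)%N ->
  symmx (adjmx (cycle_graph n) *m perm_mx p *m adjmx (cycle_graph n)) ->
  symmx (perm_mx p).
Proof.
move=> n8; have n2 : (2 < n)%N by apply: leq_trans n8.
set A := adjmx _; pose D : 'M[int]_n := perm_mx p - (perm_mx p)^T.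
have trA : A^T = A by apply: tr_adjmx.
rewrite /symmx !trmx_mul trA mulmxA => symAPA.
have ADA : A *m (D *m A) = 0.
  by rewrite mulmxA mulmxBr mulmxBl symAPA subrr.
have trD : D^T = - D by rewrite /D linearB /= trmxK opprB.
(* Two candidate rows for each of the columns [v + 1] and [v - 1] of [D] give [m = 4]; the
   requirement [2m < n] is then exactly [8 < n]. *)
have DA : D *m A = 0.
  apply: (eq0_of_adj_cycle_sparse (m := 4) n2 n8 ADA) => v.
  exists [:: p (ordS v); (p^-1)%g (ordS v);
             p (ord_pred v); (p^-1)%g (ord_pred v)] => // u.
  have -> : (D *m A) u v = D u (ordS v) + D u (ord_pred v).
    rewrite -[D *m A]trmxK mxE trmx_mul trA mulmx_adj_cycle //.
    by rewrite !mxE.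
  apply: contraR; rewrite -[X in u \notin X]/([:: _; _] ++ [:: _; _]).
  rewrite mem_cat negb_or => /andP[uS up].
  have -> : D u (ordS v) = 0.
    by apply/eqP; apply: contraR uS => /perm_mx_subtr_neq0.
  by rewrite add0r; apply: contraR up => /perm_mx_subtr_neq0.
(* As [D] is antisymmetric and [A] symmetric, transposing [D A = 0] puts [A] on the left, and the
   sparsity bound now applies to [D] itself. *)
have AD : A *m D = 0.
  by apply: trmx_inj; rewrite trmx_mul trA trD mulNmx DA oppr0 trmx0.
have /eqP : D = 0.
  apply: (eq0_of_adj_cycle_sparse (m := 2) n2 _ AD); first exact: leq_trans n8.
  by move=> v; exists [:: p v; (p^-1)%g v] => // u /perm_mx_subtr_neq0.
by rewrite subr_eq0 => /eqP <-.
Qed.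

Theorem theorem3p10 (n : nat) (hn : (8 < n)%N) :
  (forall P : 'M[int]_n, is_perm_mx P ->
     (symmx (adjmx (cycle_graph n) *m P *m adjmx (cycle_graph n)) <-> symmx P))
  /\
  (forall p : 'S_n, (p ^+ 2)%g <> 1%g ->
     ~ exists G : graph n, is_perm_power1 (cycle_graph n) p G).
Proof.
split=> [P /is_perm_mxP[p ->] | p p2 [G [symM _]]].
  split; first exact: symmx_cycle_perm_mx.
  by rewrite /symmx => symP; rewrite !trmx_mul tr_adjmx symP mulmxA.
apply: p2; have := symmx_cycle_perm_mx hn symM.
rewrite /symmx => /matrixP symp; apply/permP => u; rewrite expgS expg1 permM perm1.
(* The entry of [perm_mx p] at [(u, p u)] is 1, so by symmetry the one at [(p u, u)] is too, which
   says [p (p u) = u]. *)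
have := symp u (p u); rewrite !mxE eqxx.
by case: eqP.
Qed.
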